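(* Let $A$ be an alternative finite-dimensional real $*$-algebra with quadratic cone $Q_A$ and pseudosphere $\mathbb{S}_A$. Let $\Omega_G\subset Q_A$ be the axially symmetric domain associated to a symmetric domain $G$ in $\mathbb{C}$. Then there exists a discrete subset $D$ of $\Omega_G$ such that: (i) for every $x,y\in\mathbb{R}$ the intersection $(x+y\mathbb{S}_A)\cap D$ contains at most one point; (ii) the closure of $D$ in $Q_A$ contains the boundary $\partial\Omega_G$ of $\Omega_G$ in $Q_A$; (iii) $\tilde D=\{x+yi: x,y\in\mathbb{R},\ \exists J\in\mathbb{S}_A: x+yJ\in D\}$ is discrete in $G$.
   Context: A finite-dimensional alternative real $*$-algebra $A$ is a finite-dimensional unital real algebra ($\mathbb{R}=\mathbb{R}\cdot 1\subset A$) with $x(xy)=(xx)y$ and $x(yy)=(xy)y$ for all $x,y\in A$, equipped with a real-linear involution $x\mapsto x^c$ satisfying $(xy)^c=y^cx^c$ and fixing $\mathbb{R}$ pointwise. The pseudosphere is $\mathbb{S}_A=\{w\in A: w+w^c=0,\ ww^c=1\}$ (so $w^2=-1$ for $w\in\mathbb{S}_A$); the quadratic cone is $Q_A=\mathbb{R}\cup\{w\in A: w+w^c\in\mathbb{R},\ ww^c\in\mathbb{R},\ 4ww^c>(w+w^c)^2\}$, equivalently $Q_A=\mathbb{R}\cup\{x+yI:x,y\in\mathbb{R},I\in\mathbb{S}_A\}$, with the subspace topology from the finite-dimensional vector space $A$. A symmetric domain in $\mathbb{C}$ is an open subset $G$ with $z\in G\iff\bar z\in G$ whose quotient by the relation $z\sim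 w\iff(z=w\text{ or }z=\bar w)$ is connected. Its associated axially symmetric domain is $\Omega_G=\{x+yI: x+yi\in G,\ x,y\in\mathbb{R},\ I\in\mathbb{S}_A\}\subset Q_A$. A subset of a space is called discrete in it if it has no accumulation point in that space. *)

(* Defs.v *)
From HB Require Import structures.
From mathcomp Require Import all_boot all_order all_algebra.
From mathcomp Require Import all_classical all_reals all_analysis.
From mathcomp Require Import complex.

Set Implicit Arguments.
Unset Strict Implicit.
Unset Printing Implicit Defensive.

Import Order.TTheory GRing.Theory Num.Theory.
Import numFieldNormedType.Exports.

Local Open Scope classical_set_scope.
Local Open Scope ring_scope.
Local Open Scope complex_scope.

(* The product is not assumed associative, so MathComp's ring structures do
   not apply.  The real scalar t of the algebra is t *: aone, and aone_neq0
   makes R embed into A. *)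
HB.mixin Record Vector_isAltStarAlg (R : realType) A of Vector R A := {
  aone : A;
  amul : A -> A -> A;
  aconj : A -> A;
  aone_neq0 : aone != 0;
  amul1x : left_id aone amul;
  amulx1 : right_id aone amul;
  amul_linearl : forall y, linear (fun x => amul x y);
  amul_linearr : forall x, linear (fun y => amul x y);
  amul_altl : forall x y, amul x (amul x y) = amul (amul x x) y;
  amul_altr : forall x y, amul x (amul y y) = amul (amul x y) y;
  aconj_linear : linear aconj;
  aconjK : involutive aconj;
  aconjM : forall x y, aconj (amul x y) = amul (aconj y) (aconj x);
  aconj_real : forall t : R, aconj (t *: aone) = t *: aone
}.

#[short(type="altStarAlgType")]
HB.structure Definition AltStarAlg (R : realType) :=
  {A of Vector R A & Vector_isAltStarAlg R A}.

(* The usual topology of a finite-dimensional real vector space, transported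
   from 'rV_n by a coordinate isomorphism; it does not depend on the choice of
   the isomorphism, as linear automorphisms of 'rV_n are homeomorphisms. *)
Definition findim (R : realType) (A : vectType R) : Type := A.

HB.instance Definition _ (R : realType) (A : vectType R) :=
  Choice.on (findim A).
HB.instance Definition _ (R : realType) (A : vectType R) :=
  Topological.copy (findim A)
    (initial_topology (@VectorInternalTheory.v2r R A : A -> 'rV[R]_(dim A))).

(* [subspace X] carries the relative topology on X and makes every point
   outside X isolated; the two operators below are only used for S `<=` X,
   where they are the closure and the boundary of S in the space X. *)
Definition closure_in (T : topologicalType) (X S : set T) : set T :=
  @closure (subspace X) S.

Definition boundary_in (T : topologicalType) (X S : set T) : set T :=
  closure_in X S `\` @interior (subspace X) S.

Definition discrete_in (T : topologicalType) (X S : set T) : Prop :=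
  S `<=` X /\ forall p, X p -> ~ @limit_point (subspace X) S p.

Section StarAlgebra.
Context {R : realType} (A : altStarAlgType R).

Definition pseudosphere : set A :=
  [set w | w + aconj w = 0 /\ amul w (aconj w) = aone].

Definition quadratic_cone : set A :=
  [set w | (exists t : R, w = t *: aone) \/
           (exists t n : R, [/\ w + aconj w = t *: aone,
                                amul w (aconj w) = n *: aone &
                                t ^+ 2 < 4 * n])].

End StarAlgebra.

Arguments pseudosphere {R} A _.
Arguments quadratic_cone {R} A _.

(* The complex numbers, with the topology given by the modulus. *)
Definition Cplx (R : realType) : topologicalType := (R[i])^o.

Section SymmetricDomain.
Context {R : realType}.

Section ConjugationQuotient.
Context (G : set (Cplx R)).

Definition conj_rel : rel (set_type G) := fun z w =>
  (set_val z == set_val w) || (set_val z == (set_val w)^* :> R[i]).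

Lemma conj_rel_refl : reflexive conj_rel.
Proof. by move=> z; rewrite /conj_rel eqxx. Qed.

Lemma conj_rel_sym : symmetric conj_rel.
Proof.
move=> z w; rewrite /conj_rel eq_sym; congr (_ || _).
by apply/eqP/eqP => ->; rewrite conjcK.
Qed.

Lemma conj_rel_trans : transitive conj_rel.
Proof.
move=> w z u /orP[]/eqP zw /orP[]/eqP wu; rewrite /conj_rel zw wu ?conjcK;
  by rewrite eqxx ?orbT.
Qed.

Canonical conj_equiv :=
  EquivRel conj_rel conj_rel_refl conj_rel_sym conj_rel_trans.

Definition conj_quotient : topologicalType :=
  quotient_topology {eq_quot conj_equiv}%qT.

End ConjugationQuotient.

Definition symmetric_domain (G : set (Cplx R)) : Prop :=
  [/\ open G,
      forall z : R[i], G z <-> G z^* &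
      connected [set: conj_quotient G]].

Context (A : altStarAlgType R).

Definition axially_symmetric_domain (G : set (Cplx R)) : set A :=
  [set w | exists x y : R, exists I : A,
    [/\ G (x +i* y), pseudosphere A I & w = x *: aone + y *: I]].

Definition sphere_at (x y : R) : set A :=
  [set x *: aone + y *: I | I in pseudosphere A].

Definition complex_trace (D : set A) : set (Cplx R) :=
  [set z | exists x y : R, exists J : A,
    [/\ z = x +i* y, pseudosphere A J & D (x *: aone + y *: J)]].

End SymmetricDomain.

Arguments axially_symmetric_domain {R} A G _.
Arguments sphere_at {R} A x y _.
Arguments complex_trace {R A} D _.

(* Main.v *)
From HB Require Import structures.
Require Import Defs.
From mathcomp Require Import all_boot all_order all_algebra.
From mathcomp Require Import all_classical all_reals all_analysis.
From mathcomp Require Import complex ring lra.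
Set Implicit Arguments.
Unset Strict Implicit.
Unset Printing Implicit Defensive.
Import Order.TTheory GRing.Theory Num.Theory.
Import numFieldNormedType.Exports VectorInternalTheory.
Local Open Scope classical_set_scope.
Local Open Scope ring_scope.
Local Open Scope complex_scope.

(** Write w in the quadratic cone as x + yI with I in the pseudosphere.  The pair
    (x, |y|) depends only on w and is a continuous function phi of w: it can be
    read off the real numbers w + w^c = 2x and w w^c = x^2 + y^2.  If the
    pseudosphere is empty, so is Omega, and the empty set serves as D.  Otherwise,
    by the symmetry of G, the domain Omega is the set of points of the cone that
    phi sends into G (seen in the plane); hence Omega is relatively open in the cone, and phi maps
    each point of its boundary outside G while such a point is still a limit of
    points of Omega.

    The set D is built from a countable basis (B_n) of A.  For each n such that
    B_n meets the boundary, pick a boundary point w_n in B_n, and then a point d_n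
    of Omega in B_n so close to w_n that phi(d_n) and phi(w_n) are at distance
    less than 1/(n+1), with phi(d_n) different from all the earlier phi(d_m).  The
    last requirement can be met because phi(w_n), being outside G, has a
    neighbourhood avoiding the finitely many earlier values.  This is
    [exists_locally_finite_dense_at_boundary].

    All three claims follow.  Two points of D on one sphere x + yS have the same
    image under phi, so they coincide.  Each boundary point is in the closure of
    D, since D meets every basic set that meets the boundary.  Finally the phi(d_n)
    cannot accumulate at a point of G, as phi(w_n) is outside the open set G and
    the distances tend to 0; so D is locally finite over G, which gives
    discreteness of D in Omega ([discrete_in_domain]) and of its trace in G
    ([discrete_in_trace]). *)

(** * Approximating a boundary by a locally finite set *)

Lemma nbhs_setC_finite (T : topologicalType) (p : T) (F : set T) :
  accessible_space T -> finite_set F -> ~ F p -> nbhs p (~` F).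
Proof.
move=> T1 finF nFp; apply: open_nbhs_nbhs; split => //.
by apply: closed_openC; move/accessible_finite_set_closed: T1; apply.
Qed.

(** Discreteness is obtained below from local finiteness, which pulls back along
    continuous maps with finite fibres.  By the T1 axiom, a neighbourhood of p that
    meets S in a finite set shrinks to one that meets S at most in p. *)
Lemma finite_near_not_limit_point (T : topologicalType) (X S V : set T)
    (p : T) :
  accessible_space T -> X p -> nbhs p V -> finite_set (S `&` V) ->
  ~ @limit_point (subspace X) S p.
Proof.
move=> T1 Xp pV finSV lim.
have pW : nbhs p (V `&` ~` ((S `&` V) `\ p)).
  apply: filterI => //; apply: nbhs_setC_finite => //.
    exact: finite_setD.
  by case=> _ /(_ erefl).
have [y [/eqP yp Sy [Vy]]] := lim _ (@incl_subspace_continuous _ X p _ pW).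
by case.
Qed.

Section BoundarySequence.
Context {R : realType} (X : topologicalType) (Y : pseudoMetricType R).
Variables (phi : X -> Y) (Om Bd : set X) (G : set Y).
Hypothesis T1Y : accessible_space Y.
Hypothesis phi_cont : continuous phi.
Hypothesis openG : open G.
Hypothesis OmG : Om `<=` phi @^-1` G.
Hypothesis BdcOm : Bd `<=` closure Om.
Hypothesis BdG : Bd `<=` phi @^-1` (~` G).

(** A point w of Bd has its image outside G, so a finite subset F of G does not
    obstruct the approximation of w by points of Om. *)
Lemma exists_fresh_point_near (w : X) (U : set X) (e : R) (F : set Y) :
  Bd w -> nbhs w U -> 0 < e -> finite_set F -> F `<=` G ->
  exists d, [/\ Om d, U d, ball (phi w) e (phi d) & ~ F (phi d)].
Proof.
move=> Bw wU e0 finF FG.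
have wF : nbhs (phi w) (~` F) by apply: nbhs_setC_finite => // /FG; exact: BdG.
have [d [Od [[Ud bd] nFd]]] := BdcOm Bw (filterI (filterI wU
  (phi_cont (nbhsx_ballx (phi w) e e0))) (phi_cont wF)).
by exists d.
Qed.

(** The recursion runs over lists: the next point depends on the whole list of
    earlier ones, whose images it must avoid. *)
Lemma boundary_sequence (w : nat -> X) (C : nat -> set X) :
  (forall n, Bd (w n)) -> (forall n, nbhs (w n) (C n)) ->
  exists d : nat -> X, [/\ forall n, Om (d n), forall n, C n (d n),
    forall n, ball (phi (w n)) n.+1%:R^-1 (phi (d n)) &
    injective (phi \o d)].
Proof.
move=> Bw wC.
(* Intersecting with G makes the choice below unconditional: it applies to every
   list, whether or not its points are in Om. *)
pose used (s : seq X) := phi @` [set x | x \in s] `&` G.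
have /choice[f fP] (s : seq X) : exists d, [/\ Om d, C (size s) d,
    ball (phi (w (size s))) (size s).+1%:R^-1 (phi d) & ~ used s (phi d)].
  apply: exists_fresh_point_near => //; last by move=> ? [].
  by apply: finite_setIl; apply: finite_image; exact: finite_seq.
pose fix s n := if n is m.+1 then rcons (s m) (f (s m)) else [::].
have size_s n : size (s n) = n by elim: n => //= n ih; rewrite size_rcons ih.
have sub_s m n : (m < n)%N -> f (s m) \in s n.
  elim: n => // n ih; rewrite ltnS leq_eqVlt => /predU1P[->|/ih mn] /=.
    by rewrite mem_rcons mem_head.
  by rewrite mem_rcons in_cons mn orbT.
have new m n : (m < n)%N -> phi (f (s m)) <> phi (f (s n)).
  move=> mn eq_phi; have [_ _ _] := fP (s n); apply; rewrite -eq_phi; split.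
    by exists (f (s m)) => //; exact: sub_s.
  by apply: OmG; have [] := fP (s m).
exists (f \o s); split => [n|n|n|m n /= eq_phi] /=.
- by have [] := fP (s n).
- by have [_] := fP (s n); rewrite size_s.
- by have [_ _] := fP (s n); rewrite size_s.
- by have [/new|/new/(_ (esym eq_phi))|] := ltngtP m n.
Qed.

(** Near a point y of G only small indices occur: for large n, closeness of
    phi(d_n) to y would put phi(w_n), which is close to phi(d_n), into G. *)
Lemma boundary_sequence_locally_finite (w d : nat -> X) (y : Y) :
  (forall n, Bd (w n)) ->
  (forall n, ball (phi (w n)) n.+1%:R^-1 (phi (d n))) -> G y ->
  exists2 V, nbhs y V & finite_set (range d `&` phi @^-1` V).
Proof.
move=> Bw wd Gy.
have /nbhs_ballP[e /= e0 eG] : nbhs y G by exact: open_nbhs_nbhs.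
have e20 : 0 < e / 2 by rewrite divr_gt0.
have [N _ NP] := near_infty_natSinv_lt (PosNum e20).
exists (ball y (e / 2)); first exact: nbhsx_ballx.
apply: (@sub_finite_set _ _ (d @` `I_N)); last first.
  by apply: finite_image; exact: finite_II.
move=> _ [[n _ <-] /= yd]; exists n => //=; rewrite ltnNge; apply/negP => Nn.
apply: (BdG (Bw n)); apply: eG; rewrite (splitr e).
apply: (ball_triangle yd); apply: ball_sym.
by apply: le_ball (wd n); exact/ltW/(NP n).
Qed.

(** The heart of the proof, free of algebra.  Taking each approximating point in
    the same basic open set as the boundary point it approximates makes the
    sequence accumulate at all of Bd, and not merely at the chosen points. *)
Lemma exists_locally_finite_dense_at_boundary : @second_countable X ->
  exists D : set X, [/\ D `<=` Om, {in D &, injective phi},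
    Bd `<=` closure D &
    forall y, G y -> exists2 V, nbhs y V & finite_set (D `&` phi @^-1` V)].
Proof.
move=> [B cB [oB bB]].
have [->|/set0P[w0 Bw0]] := eqVneq Bd set0.
  exists set0; split => // [x y|y _]; first by rewrite inE.
  by exists setT; [exact: filterT | rewrite set0I].
have /pfcard_geP[B0|[g]] := cB.
  by have [U []] := bB w0 _ (filterT); rewrite B0.
(* A basic set that misses Bd is replaced by the whole space and a fixed point of
   Bd, so that every index carries a point. *)
have /choice[wC wCP] n : exists wC : X * set X, [/\ Bd wC.1, nbhs wC.1 wC.2 &
    Bd `&` g n !=set0 -> wC.2 `<=` g n].
  have [[w [Bw gw]]|nBg] := pselect (Bd `&` g n !=set0); last first.
    by exists (w0, setT); split => //; exact: filterT.
  exists (w, g n); split => //=; last by move=> ? ?.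
  apply: open_nbhs_nbhs; split => //.
  by apply: oB; exact: funS.
have Bw n : Bd (wC n).1 by have [] := wCP n.
have wC_nbhs n : nbhs (wC n).1 (wC n).2 by have [] := wCP n.
have [d [dOm dC dball dinj]] := boundary_sequence Bw wC_nbhs.
exists (range d); split.
- by move=> _ [n _ <-].
- by move=> _ _ /set_mem[m _ <-] /set_mem[n _ <-] /(dinj m n) ->.
- move=> w Bdw U wU; have [V [BV Vw] VU] := bB w _ wU.
  have [n _ gn] := @surj _ _ _ _ g V BV; exists (d n); split; first by exists n.
  apply: VU; rewrite -gn; have [_ _] := wCP n; apply; last exact: dC.
  by exists w; rewrite gn.
- by move=> y; apply: (boundary_sequence_locally_finite Bw dball).
Qed.

End BoundarySequence.

(** * Topology of a finite-dimensional space *)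

Section FiniteDimensional.
Context {R : realType} {A : vectType R}.

Lemma findim_coord_continuous j : continuous (fun x : findim A => v2r x 0 j).
Proof.
move=> x; apply: (continuous_comp (f := v2r : findim A -> _)
  (g := fun M : 'rV[R]_(dim A) => M 0 j)); last exact: coord_continuous.
exact: initial_continuous.
Qed.

Lemma findim_nbhs_coord (x : findim A) (U : set (findim A)) : nbhs x U ->
  exists2 P : 'I_(dim A) -> set R, (forall j, nbhs (v2r x 0 j) (P j)) &
    forall y : findim A, (forall j, P j (v2r y 0 j)) -> U y.
Proof.
move=> [_ [[V oV <-] Vx VU]].
have [P Px PV] : nbhs (v2r x) V by exact: open_nbhs_nbhs.
exists (P 0) => // y Py; apply: VU; apply: PV => i j.
by rewrite ord1; exact: Py.
Qed.

Lemma findim_accessible : accessible_space (findim A).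
Proof.
move=> x y xy; have [j] : exists j, v2r x 0 j != v2r y 0 j.
  apply: contrapT => /forallNP eqxy; case/eqP: xy.
  suff : v2r x = v2r y by move=> /(@v2r_inj R A).
  apply/rowP => j.
  by have /negP := eqxy j; rewrite negbK => /eqP.
move=> xyj; exists (~` ((fun z : findim A => v2r z 0 j) @^-1` [set v2r y 0 j])).
split.
- apply: closed_openC; apply: closed_comp => [z _|].
    exact: findim_coord_continuous.
  by apply: accessible_closed_set1; exact/hausdorff_accessible/Rhausdorff.
- by rewrite inE /=; exact/eqP.
- by rewrite setCK inE.
Qed.

Lemma nbhs_rat_itv (x : R) (P : set R) : nbhs x P ->
  exists q : rat * rat, ratr q.1 < x < ratr q.2 /\
    `]ratr q.1, ratr q.2[%classic `<=` P.
Proof.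
move=> /nbhs_ballP[e /= e0 eP].
have /rat_in_itvoo[a] : x - e < x by rewrite ltrBlDr ltrDl.
rewrite in_itv /= => /andP[ea ax].
have /rat_in_itvoo[b] : x < x + e by rewrite ltrDl.
rewrite in_itv /= => /andP[xb be].
exists (a, b); split => /=; first by rewrite ax.
move=> y /=; rewrite in_itv /= => /andP[ay yb]; apply: eP.
by rewrite /ball /= distrC ltr_distl (lt_trans ea)//= (lt_trans yb).
Qed.

(** The basis consists of the coordinate boxes with rational vertices. *)
Lemma findim_second_countable : @second_countable (findim A).
Proof.
pose box (q : {ffun 'I_(dim A) -> rat * rat}) : set (findim A) :=
  [set x | forall j, ratr (q j).1 < v2r x 0 j < ratr (q j).2].
exists (range box); [|split].
- by apply: card_le_trans (card_image_le _ _) _; exact: countableP.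
- move=> _ [q _ <-]; rewrite openE => x xq.
  apply: (@filter_forall _ _ (fun j => [set y : findim A |
    ratr (q j).1 < v2r y 0 j < ratr (q j).2]) (nbhs (x : findim A))) => j.
  apply: (@findim_coord_continuous j x
    [set t | ratr (q j).1 < t < ratr (q j).2]).
  rewrite -set_itvoo; apply: open_nbhs_nbhs; split; first exact: itv_open.
  by rewrite set_itvoo; exact: xq.
- move=> x U /findim_nbhs_coord[P Px PU].
  have /choice[q qP] j := nbhs_rat_itv (Px j).
  exists (box [ffun j => q j]).
    split; first by exists [ffun j => q j].
    by move=> j; rewrite ffunE; have [] := qP j.
  move=> y yq; apply: PU => j; have [_] := qP j; apply.
  by rewrite /= in_itv /=; have := yq j; rewrite ffunE.
Qed.

Lemma scalar_coordE (f : {scalar A}) (w : A) :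
  f w = \sum_j v2r w 0 j * f (r2v (delta_mx 0 j)).
Proof.
rewrite -{1}[w]v2rK {1}(row_sum_delta (v2r w)) !linear_sum /=.
by apply: eq_bigr => j _; rewrite !linearZ.
Qed.

Lemma findim_scalar_continuous (f : A -> R) :
  scalar f -> continuous (f : findim A -> R).
Proof.
move=> lin_f.
pose F : {scalar A} :=
  HB.pack f (GRing.isLinear.Build R A R _ f lin_f).
rewrite (funext (scalar_coordE F : forall w : findim A, f w = _)).
apply: (@continuous_big R _ _ _ _ _ (findim A)) => [|j _ w].
  exact: add_continuous.
exact: (continuousM (@findim_coord_continuous j w) (@cst_continuous _ _ _ w)).
Qed.

(** Expanding one argument in coordinates reduces the claim to the continuity of
    linear functionals. *)
Lemma findim_bilinear_continuous (b : A -> A -> R) :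
  (forall y, scalar (b^~ y)) -> (forall x, scalar (b x)) ->
  continuous ((fun w => b w w) : findim A -> R).
Proof.
move=> linl linr.
have bE (w : findim A) : b w w = \sum_j v2r w 0 j * b (r2v (delta_mx 0 j)) w.
  pose F : {scalar A} :=
    HB.pack (b^~ w) (GRing.isLinear.Build R A R _ (b^~ w) (linl w)).
  exact: (scalar_coordE F w).
rewrite (funext bE).
apply: (@continuous_big R _ _ _ _ _ (findim A)) => [|j _ w].
  exact: add_continuous.
exact: (continuousM (@findim_coord_continuous j w)
  (@findim_scalar_continuous _ (linr _) w)).
Qed.

End FiniteDimensional.

(** * The spheres x + yS inside the quadratic cone *)

Section PseudosphereAlgebra.
Context {R : realType} {A : altStarAlgType R}.
Implicit Types (x y t n : R) (u v w I : A).

Lemma aconjD u v : aconj (u + v) = aconj u + aconj v.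
Proof. by have := aconj_linear 1 u v; rewrite !scale1r. Qed.

Lemma aconj0 : aconj (0 : A) = 0.
Proof. by apply: (@addrI _ (aconj 0)); rewrite -aconjD !addr0. Qed.

Lemma aconjZ t u : aconj (t *: u) = t *: aconj u.
Proof. by have := aconj_linear t u 0; rewrite aconj0 !addr0. Qed.

Lemma amulDl u v w : amul (u + v) w = amul u w + amul v w.
Proof. by have := amul_linearl w 1 u v; rewrite !scale1r. Qed.

Lemma amulDr u v w : amul w (u + v) = amul w u + amul w v.
Proof. by have := amul_linearr w 1 u v; rewrite !scale1r. Qed.

Lemma amul0l w : amul 0 w = 0.
Proof. by apply: (@addrI _ (amul 0 w)); rewrite -amulDl !addr0. Qed.

Lemma amul0r w : amul w 0 = 0.
Proof. by apply: (@addrI _ (amul w 0)); rewrite -amulDr !addr0. Qed.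

Lemma amulZl t u w : amul (t *: u) w = t *: amul u w.
Proof. by have := amul_linearl w t u 0; rewrite amul0l !addr0. Qed.

Lemma amulZr t u w : amul w (t *: u) = t *: amul w u.
Proof. by have := amul_linearr w t u 0; rewrite amul0r !addr0. Qed.

Lemma pseudosphere_conj I : pseudosphere A I -> aconj I = - I.
Proof. by case=> /eqP; rewrite addrC addr_eq0 => /eqP. Qed.

Lemma trace_sphere x y I : pseudosphere A I ->
  let w := x *: aone + y *: I in w + aconj w = (x *+ 2) *: aone.
Proof.
move=> SI /=; rewrite aconjD aconj_real aconjZ (pseudosphere_conj SI) scalerN.
by rewrite addrACA subrr addr0 -mulr2n scalerMnl.
Qed.

Lemma norm_shift x w : amul (x *: aone + w) (aconj (x *: aone + w)) =
  x ^+ 2 *: aone + x *: (w + aconj w) + amul w (aconj w).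
Proof.
rewrite aconjD aconj_real amulDl !amulDr !amulZl !amulZr !amul1x !amulx1.
by rewrite scalerA -expr2 scalerDr !addrA [_ + x *: w]addrAC.
Qed.

Lemma norm_sphere x y I : pseudosphere A I ->
  let w := x *: aone + y *: I in
  amul w (aconj w) = (x ^+ 2 + y ^+ 2) *: aone.
Proof.
move=> SI /=; rewrite norm_shift aconjZ -scalerDr amulZl amulZr.
by case: SI => -> ->; rewrite !scaler0 addr0 scalerA -expr2 scalerDl.
Qed.

Lemma sphere_in_cone x y I : pseudosphere A I ->
  quadratic_cone A (x *: aone + y *: I).
Proof.
move=> SI; have [->|y0] := eqVneq y 0.
  by left; exists x; rewrite scale0r addr0.
right; exists (x *+ 2), (x ^+ 2 + y ^+ 2).
split; [exact: trace_sphere|exact: norm_sphere|].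
have : 0 < y ^+ 2 by rewrite exprn_even_gt0.
by nra.
Qed.

(** The imaginary unit of w is I = (w - x) / y with x half the trace of w and
    y^2 = w w^c - x^2, which is positive off the real line.  A real w is on the
    degenerate spheres with y = 0, which are nonempty only if the pseudosphere is:
    hence I0. *)
Lemma cone_sphere w I0 : pseudosphere A I0 -> quadratic_cone A w ->
  exists x y I, [/\ pseudosphere A I, 0 <= y & w = x *: aone + y *: I].
Proof.
move=> SI0 [[t ->]|[t [n [trw nw tn]]]].
  by exists t, 0, I0; rewrite scale0r addr0.
pose x := t / 2; pose y := Num.sqrt (n - x ^+ 2).
have r0 : 0 < n - x ^+ 2 by rewrite /x; lra.
have y0 : 0 < y by rewrite sqrtr_gt0.
have y2 : y ^+ 2 = n - x ^+ 2 by rewrite sqr_sqrtr // ltW.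
pose v := - x *: aone + w.
have trv : v + aconj v = 0.
  rewrite /v aconjD aconj_real addrACA trw -!scalerDl.
  by rewrite (_ : _ + _ = 0) ?scale0r // /x; lra.
have nv : amul v (aconj v) = y ^+ 2 *: aone.
  rewrite norm_shift trw nw scalerA -!scalerDl y2; congr (_ *: _).
  by rewrite /x; lra.
exists x, y, (y^-1 *: v); split; last 2 first.
- exact: ltW.
- by rewrite scalerA divff ?gt_eqF // scale1r /v addrA scaleNr subrr add0r.
split; first by rewrite aconjZ -scalerDr trv scaler0.
rewrite aconjZ amulZl amulZr nv !scalerA.
by rewrite (_ : _ * _ = 1) ?scale1r // expr2; field; rewrite gt_eqF.
Qed.

End PseudosphereAlgebra.

(** * Closure in a subspace *)

Lemma closure_in_subset (T : topologicalType) (X S : set T) :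
  S `<=` X -> closure_in X S `<=` X `&` closure S.
Proof.
move=> SX p clp; split.
  apply: contrapT => nXp; have [] := clp [set p].
    exact/(@open_nbhs_nbhs (subspace X))/(conj (open_subspace1out nXp)).
  by move=> q [/SX Xq /= qp]; apply: nXp; rewrite -qp.
by move=> U pU; exact: clp (@incl_subspace_continuous _ X p _ pU).
Qed.

Lemma closure_inI (T : topologicalType) (X S : set T) (p : T) :
  S `<=` X -> X p -> closure S p -> closure_in X S p.
Proof.
move=> SX Xp clp U /(nbhs_subspace_ex _ Xp)[V pV UV].
have [q [Sq Vq]] := clp _ pV; exists q; split => //.
by have [] : (U `&` X) q by rewrite UV; split => //; exact: SX.
Qed.

(** * Real coordinates on the complex plane *)

Section ComplexPlane.
Context {R : realType}.

Lemma ball_CplxE (z w : R[i]) (e : R) :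
  ball (z : (R[i])^o) e%:C w =
  (Num.sqrt ((complex.Re z - complex.Re w) ^+ 2 +
             (complex.Im z - complex.Im w) ^+ 2) < e).
Proof.
rewrite -ball_normE /ball_ /= normc_def; case: z w => [a b] [c d].
by rewrite ltcR.
Qed.

Lemma Re_continuous : continuous (fun z : Cplx R => complex.Re z : R).
Proof.
move=> z U /nbhs_ballP[e /= e0 eU].
have zB : nbhs (z : Cplx R) (ball (z : (R[i])^o) e%:C).
  by apply: (@nbhsx_ballx _ (R[i])^o); rewrite ltcR.
apply: (@filterS _ _ (nbhs_filter z) _ _ _ zB) => w; rewrite ball_CplxE => zw.
apply: eU; rewrite /ball /=; apply: le_lt_trans zw.
by rewrite -sqrtr_sqr ler_wsqrtr // lerDl sqr_ge0.
Qed.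

Lemma Im_continuous : continuous (fun z : Cplx R => complex.Im z : R).
Proof.
move=> z U /nbhs_ballP[e /= e0 eU].
have zB : nbhs (z : Cplx R) (ball (z : (R[i])^o) e%:C).
  by apply: (@nbhsx_ballx _ (R[i])^o); rewrite ltcR.
apply: (@filterS _ _ (nbhs_filter z) _ _ _ zB) => w; rewrite ball_CplxE => zw.
apply: eU; rewrite /ball /=; apply: le_lt_trans zw.
by rewrite -sqrtr_sqr ler_wsqrtr // lerDr sqr_ge0.
Qed.

Lemma mkcomplex_continuous :
  continuous (fun p : R * R => p.1 +i* p.2 : Cplx R).
Proof.
move=> [a b] U /= /(@nbhs_ballP _ (R[i])^o)[e /= e0 eU].
(* A positive element of the complex numbers is a positive real. *)
have [r r0 er] : exists2 r : R, 0 < r & e = r%:C.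
  by case: e e0 {eU} => r s; rewrite ltcE /= => /andP[/eqP -> r0]; exists r.
apply/nbhs_ballP; exists (r / 2) => /=; first by rewrite divr_gt0.
move=> [c d] [/= ac bd]; apply: eU; rewrite er ball_CplxE /=.
have := ac; rewrite /ball /= => {}ac.
have := bd; rewrite /ball /= => {}bd.
rewrite -[ltRHS]ger0_norm ?(ltW r0) // -sqrtr_sqr ltr_sqrt ?exprn_gt0 //.
rewrite -(real_normK (num_real (a - c))) -(real_normK (num_real (b - d))).
have := normr_ge0 (a - c); have := normr_ge0 (b - d); nra.
Qed.

Lemma Cplx_accessible : accessible_space (Cplx R).
Proof. by apply: hausdorff_accessible; exact: (@norm_hausdorff _ (R[i])^o). Qed.

End ComplexPlane.

(** * The coordinates (x, |y|) of a point x + yI *)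

Lemma exists_unit_scalar {R : realType} (A : vectType R) (e : A) : e != 0 ->
  exists tau : A -> R, scalar tau /\ tau e = 1.
Proof.
move=> e0; have [j ej] : exists j, v2r e 0 j != 0.
  apply: contrapT => /forallNP ej; case/eqP: e0; apply: v2r_inj.
  rewrite linear0; apply/rowP => j; rewrite mxE.
  by have /negP := ej j; rewrite negbK => /eqP.
exists (fun w => v2r w 0 j / v2r e 0 j); split; last by rewrite divff.
by move=> t u v; rewrite linearD linearZ !mxE mulrDl mulrA.
Qed.

(** On the cone w + w^c and w w^c are real multiples of the unit; applying a linear
    functional tau with tau(1) = 1 extracts these multiples by a formula that makes
    sense, and is continuous, on all of A. *)
Lemma exists_cone_coordinates {R : realType} (A : altStarAlgType R) :
  exists phi : findim A -> R * R, continuous phi /\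
    forall (x y : R) (I : A), pseudosphere A I ->
      phi (x *: aone + y *: I) = (x, `|y|).
Proof.
have [tau [lin_tau tau1]] := exists_unit_scalar (@aone_neq0 R A).
have tau0 : tau 0 = 0.
  by have := lin_tau (-1) 0 0; rewrite scaler0 addr0 mulN1r addNr.
have tauZ t : tau (t *: aone) = t.
  by have := lin_tau t aone 0; rewrite tau0 !addr0 tau1 mulr1.
pose re w := tau (w + aconj w) / 2; pose nm w := tau (amul w (aconj w)).
have re_cont : continuous (re : findim A -> R).
  apply: findim_scalar_continuous => t u v.
  rewrite /re aconjD aconjZ addrACA -scalerDr lin_tau; lra.
have nm_cont : continuous (nm : findim A -> R).
  apply: (@findim_bilinear_continuous R A (fun u v => tau (amul u (aconj v)))).
    by move=> y t u v; rewrite amulDl amulZl lin_tau.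
  by move=> y t u v; rewrite aconjD aconjZ amulDr amulZr lin_tau.
exists (fun w => (re w, Num.sqrt (nm w - re w ^+ 2))); split.
  have sqrt_cont : continuous
      ((fun w => Num.sqrt (nm w - re w ^+ 2)) : findim A -> R).
    move=> w; apply: (@continuous_comp (findim A) R R
      (fun w => nm w - re w ^+ 2) Num.sqrt); last exact: sqrt_continuous.
    apply: (continuousB (nm_cont w)).
    exact: (continuousM (re_cont w) (re_cont w)).
  by move=> w; apply: (cvg_pair (re_cont w) (sqrt_cont w)).
move=> x y I SI; rewrite /re /nm trace_sphere // norm_sphere // !tauZ.
congr pair; first by field.
rewrite -[in RHS]sqrtr_sqr; congr Num.sqrt.
by field.
Qed.

(** * The axially symmetric domain over a symmetric domain *)

Section SymmetricDomainCone.
Context {R : realType} {A : altStarAlgType R}.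
Variables (G : set (Cplx R)) (phi : findim A -> R * R).
Hypothesis openG : open G.
Hypothesis symG : forall z : R[i], G z <-> G z^*.
Hypothesis phi_cont : continuous phi.
Hypothesis phi_sphere : forall (x y : R) (I : A), pseudosphere A I ->
  phi (x *: aone + y *: I) = (x, `|y|).

Let Q : set (findim A) := quadratic_cone A.
Let Omega : set (findim A) := axially_symmetric_domain A G.
Let G2 : set (R * R) := [set p | G (p.1 +i* p.2)].

Lemma symmetric_normE x y : G (x +i* `|y|) <-> G (x +i* y).
Proof.
have [y0|y0] := lerP 0 y; first by rewrite ger0_norm.
by rewrite ltr0_norm // symG /= opprK.
Qed.

Lemma axially_symmetric_domain_sub_cone : Omega `<=` Q.
Proof. by move=> _ [x [y [I [_ SI ->]]]]; exact: sphere_in_cone. Qed.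

Lemma axially_symmetric_domain_sub_preimage : Omega `<=` phi @^-1` G2.
Proof.
move=> _ [x [y [I [Gxy SI ->]]]] /=.
by rewrite /G2 /= phi_sphere //=; apply/symmetric_normE.
Qed.

Lemma cone_preimage_sub_axially_symmetric_domain (I0 : A) : pseudosphere A I0 ->
  Q `&` phi @^-1` G2 `<=` Omega.
Proof.
move=> SI0 w [/(cone_sphere SI0)[x [y [I [SI y0 ->]]]]] /=.
rewrite /G2 /= phi_sphere //= ger0_norm // => Gxy.
by exists x, y, I.
Qed.

Lemma open_real_domain : open G2.
Proof.
rewrite (_ : G2 = (fun p : R * R => p.1 +i* p.2 : Cplx R) @^-1` G) //.
by apply: open_comp => // p _; exact: mkcomplex_continuous.
Qed.

(** Otherwise the point would have a neighbourhood in the cone lying over G, hence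
    in Omega, and would be interior. *)
Lemma boundary_not_preimage (I0 : A) : pseudosphere A I0 ->
  boundary_in Q Omega `<=` phi @^-1` (~` G2).
Proof.
move=> SI0 w [clw intw] G2w; apply: intw.
have [Qw _] := closure_in_subset axially_symmetric_domain_sub_cone clw.
have wG2 : nbhs w (phi @^-1` G2).
  apply: phi_cont; apply: open_nbhs_nbhs; split => //.
  exact: open_real_domain.
apply/(nbhs_subspace_ex _ Qw); exists (phi @^-1` G2) => //.
apply/seteqP; split => v [+ Qv].
  by move=> /axially_symmetric_domain_sub_preimage.
move=> G2v; split => //.
exact: (cone_preimage_sub_axially_symmetric_domain SI0).
Qed.

Lemma discrete_in_domain (D : set (findim A)) :
  D `<=` Omega -> (forall p, G2 p ->
    exists2 V, nbhs p V & finite_set (D `&` phi @^-1` V)) ->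
  discrete_in Omega D.
Proof.
move=> DO fin; split => // w Ow.
have [V wV finV] := fin _ (axially_symmetric_domain_sub_preimage Ow).
apply: (finite_near_not_limit_point findim_accessible Ow _ finV).
exact: phi_cont.
Qed.

Lemma discrete_in_trace (D : set (findim A)) :
  D `<=` Omega -> (forall p, G2 p ->
    exists2 V, nbhs p V & finite_set (D `&` phi @^-1` V)) ->
  discrete_in G (complex_trace D).
Proof.
move=> DO fin; split.
  move=> _ [x [y [J [-> SJ /DO /axially_symmetric_domain_sub_preimage]]]].
  by rewrite /G2 /= phi_sphere //= => /symmetric_normE.
move=> z Gz; pose psi (z : Cplx R) : R * R := (complex.Re z, `|complex.Im z|).
have psi_cont : continuous psi.
  have normIm_cont : continuous (fun z : Cplx R => `|complex.Im z| : R).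
    move=> u; exact: (@continuous_comp (Cplx R) R R
      (fun z : Cplx R => complex.Im z) (fun t : R => `|t|) u
      (@Im_continuous R u) (@norm_continuous _ R _)).
  by move=> u; exact: (cvg_pair (@Re_continuous R u) (normIm_cont u)).
have [V zV finV] : exists2 V, nbhs (psi z) V & finite_set (D `&` phi @^-1` V).
  by apply: fin; rewrite /G2 /psi /=; apply/symmetric_normE; case: (z) Gz.
(* A point z of the trace comes from a point of D over psi z, and the latter
   determines z up to conjugation. *)
apply: (finite_near_not_limit_point (V := psi @^-1` V) Cplx_accessible Gz).
  exact: psi_cont.
pose h (w : findim A) : Cplx R := (phi w).1 +i* (phi w).2.
apply: (@sub_finite_set _ _ (h @` (D `&` phi @^-1` V) `|`
   (fun u : R[i] => u^*) @` (h @` (D `&` phi @^-1` V)))); last first.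
  by rewrite finite_setU; split; do ?[apply: finite_image].
move=> _ [[x [y [J [-> SJ Dxy]]]] /= Vxy].
have Dw : (D `&` phi @^-1` V) (x *: aone + y *: J).
  by split => //=; rewrite phi_sphere.
have hw : h (x *: aone + y *: J) = x +i* `|y| by rewrite /h phi_sphere.
have [y0|y0] := lerP 0 y.
  by left; exists (x *: aone + y *: J); rewrite // hw ger0_norm.
right; exists (h (x *: aone + y *: J)); first by exists (x *: aone + y *: J).
by rewrite hw ltr0_norm //= opprK.
Qed.

End SymmetricDomainCone.

Theorem corollary17p6 (R : realType) (A : altStarAlgType R)
    (G : set (Cplx R)) (hG : symmetric_domain G) :
  let Q : set (findim A) := quadratic_cone A in
  let Omega : set (findim A) := axially_symmetric_domain A G in
  exists D : set (findim A),
    [/\ discrete_in Omega D,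
        forall x y : R, is_subset1 (sphere_at A x y `&` D),
        boundary_in Q Omega `<=` closure_in Q D &
        discrete_in G (complex_trace D)].
Proof.
move=> Q Omega; have [openG symG _] := hG.
have OQ : Omega `<=` Q by exact: axially_symmetric_domain_sub_cone.
have [phi [phi_cont phi_sphere]] := exists_cone_coordinates A.
have [[I0 SI0]|noS] := pselect (exists I, pseudosphere A I); last first.
  have O0 : Omega = set0.
    by apply/seteqP; split => // w [x [y [I [_ SI _]]]]; case: noS; exists I.
  exists set0; split.
  - by rewrite O0; split.
  - by move=> x y u v [].
  - by move=> w [+ _]; rewrite O0.
  - apply: (discrete_in_trace symG phi_sphere) => // p _.
    by exists setT; [exact: filterT | rewrite set0I].
have Bd_cl : boundary_in Q Omega `<=` closure Omega.
  by move=> w [/(closure_in_subset OQ)[]].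
have [D [DO Dinj Dcl Dfin]] := exists_locally_finite_dense_at_boundary
  (hausdorff_accessible (@norm_hausdorff _ (R * R)%type)) phi_cont
  (open_real_domain openG)
  (axially_symmetric_domain_sub_preimage symG phi_sphere) Bd_cl
  (boundary_not_preimage openG symG phi_cont phi_sphere SI0)
  findim_second_countable.
exists D; split.
- exact: discrete_in_domain Dfin.
- move=> x y u v [[I SI <-] Du] [[J SJ <-] Dv].
  by apply: Dinj; rewrite ?inE // !phi_sphere.
- move=> w Bw; have [Qw _] := closure_in_subset OQ (proj1 Bw).
  by apply: closure_inI Qw (Dcl _ Bw) => v /DO /OQ.
- exact: discrete_in_trace Dfin.
Qed.
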